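(* Let $n\geqslant1$, let $p_1,\dots,p_n$ be distinct primes and $G=C_{p_1\cdots p_n}$. Then \[ \mathfrak{c}(G)\geqslant\begin{cases}\sum_{i=0}^{\lfloor\frac{n-1}{2}\rfloor}\binom{n}{n-i}\binom{n-i}{i+1} & n=2,4,6,\\[4pt] \sum_{i=0}^{\lfloor\frac{n-1}{2}\rfloor}\binom{n}{n-i}\binom{n-i}{i} & n\neq2,4,6.\end{cases} \] Moreover, this value is the maximal size of a rainbow on $\{0,\dots,n\}$, and it is attained by the complete rainbow when $n$ is odd, uniquely among rainbows by $R[n/2]$ when $n\geqslant8$ is even, and by both $R[0]$ and $R[n]$ when $n=2,4,6$.
   Context: For a finite group $G$, an arrow is a pair $(H,K)$ of subgroups with $H\leqslant K$; identity arrows are those with $H=K$. A $G$-transfer system is a set of arrows containing all identities and closed under composition ($(H,K),(K,L)\Rightarrow(H,L)$), conjugation ($(H,K)\Rightarrow(gHg^{-1},gKg^{-1})$) and restriction ($(H,K)$ and $L\leqslant K\Rightarrow(H\cap L,L)$). For a set $S$ of non-identity arrows, $\langle S\rangle$ is the smallest transfer system containing $S$. A minimal generating set of a transfer system $\mathsf{T}$ is a set $S\subseteq\mathsf{T}$ of non-identity arrows with $\langle S\rangle=\mathsf{T}$ and $\langle S\setminus\{s\}\rangle\neq\mathsf{T}$ for all $s\in S$; all such have the same cardinality $\mathfrak{m}(\mathsf{T})$. The complexity $\mathfrak{c}(G)$ is the maximum of $\mathfrak{m}(\mathsf{T})$ over all $G$-transfer systems $\mathsf{T}$. For $G=C_{p_1\cdots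 p_n}$ and $0\leqslant x<y\leqslant n$, the arc $\underline{x}\to\underline{y}$ stands for the set of all arrows $(H,K)$ where $|H|$ is a product of $x$ of the primes and $|K|$ a product of $y$ of the primes; it contains $\binom{n}{x,\,y-x,\,n-y}=\frac{n!}{x!(y-x)!(n-y)!}$ arrows. A rainbow on $\{0,\dots,n\}$ is a set of arcs $\{\underline{x_i}\to\underline{y_i}\}_{0\leqslant i\leqslant m}$ with $x_0<x_1<\dots<x_m<y_m<\dots<y_0$; its size is $\sum_i\binom{n}{x_i,\,y_i-x_i,\,n-y_i}$ (the number of arrows in the union of its arcs). For $n$ odd, the complete rainbow is the rainbow with arcs $\underline{i}\to\underline{n-i}$ for $0\leqslant i\leqslant\frac{n-1}{2}$ (every element of $\{0,\dots,n\}$ is an endpoint). For $n$ even and $0\leqslant x\leqslant n$, $R[x]$ is the rainbow with $\frac n2$ arcs whose endpoints are all elements of $\{0,\dots,n\}$ except $x$. Attaining the value means that the union of the arcs' arrows is a minimal generating set of the transfer system it generates, whose cardinality is the rainbow's size. *)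

(* Defs.v *)
From mathcomp Require Import all_boot all_fingroup all_solvable.
Set Implicit Arguments. Unset Strict Implicit. Unset Printing Implicit Defensive.

Local Open Scope nat_scope.

Section TransferSystems.
Variable gT : finGroupType.
Variable G : {group gT}.

Definition arrow_type := ({group gT} * {group gT})%type.

Definition is_arrow (a : arrow_type) : bool := (a.1 \subset a.2) && (a.2 \subset G).

Definition transferb (T : {set arrow_type}) : bool :=
  [&& [forall a in T, is_arrow a],
      [forall H : {group gT}, (H \subset G) ==> ((H, H) \in T)],
      [forall H : {group gT}, forall K : {group gT}, forall L : {group gT},
          ((H, K) \in T) && ((K, L) \in T) ==> ((H, L) \in T)],
      [forall H : {group gT}, forall K : {group gT}, forall g in G,
          ((H, K) \in T) ==> (((H :^ g)%G, (K :^ g)%G) \in T)] &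
      [forall H : {group gT}, forall K : {group gT}, forall L : {group gT},
          ((H, K) \in T) && (L \subset K) ==> (((H :&: L)%G, L) \in T)]].

Definition gen (S : {set arrow_type}) : {set arrow_type} :=
  \bigcap_(T | transferb T && (S \subset T)) T.

Definition minimal_genb (S T : {set arrow_type}) : bool :=
  [&& [forall a in S, a.1 != a.2], S \subset T, gen S == T &
      [forall s in S, gen (S :\ s) != T]].

(* m(T): the (common) cardinality of minimal generating sets of T *)
Definition mfrak (T : {set arrow_type}) : nat :=
  \max_(S | minimal_genb S T) #|S|.

Definition cfrak : nat := \max_(T | transferb T) mfrak T.

Definition arc_arrows (n : nat) (p : 'I_n -> nat) (x y : nat) : {set arrow_type} :=
  [set a : arrow_type | [&& is_arrow a,
     [exists I : {set 'I_n}, (#|I| == x) && (#|a.1| == \prod_(i in I) p i)] &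
     [exists I : {set 'I_n}, (#|I| == y) && (#|a.2| == \prod_(i in I) p i)]]].

Definition rainbow_arrows (n : nat) (p : 'I_n -> nat) (r : seq (nat * nat))
  : {set arrow_type} :=
  \bigcup_(a <- r) arc_arrows p a.1 a.2.

End TransferSystems.

(* Rainbows on {0,...,n}: the arcs (x_0,y_0),...,(x_m,y_m) listed in order,
   with x_0 < ... < x_m < y_m < ... < y_0 <= n, m >= 0. *)
Definition rainbow (n : nat) (r : seq (nat * nat)) : bool :=
  [&& r != [::], sorted ltn (map fst r), sorted gtn (map snd r),
      (last (0, 0) r).1 < (last (0, 0) r).2 & all (fun a => a.2 <= n) r].

Definition multinom (n x y : nat) : nat := n`! %/ (x`! * (y - x)`! * (n - y)`!).

Definition rsize (n : nat) (r : seq (nat * nat)) : nat :=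
  \sum_(a <- r) multinom n a.1 a.2.

Definition complete_rainbow (n : nat) : seq (nat * nat) :=
  [seq (i, n - i) | i <- iota 0 ((n - 1)./2).+1].

(* R[x] (n even): n/2 nested arcs on all points of {0..n} except x *)
Definition Rx (n x : nat) : seq (nat * nat) :=
  let s := [seq k <- iota 0 n.+1 | k != x] in
  [seq (nth 0 s i, nth 0 s (n - 1 - i)) | i <- iota 0 n./2].

Definition bound (n : nat) : nat :=
  if n \in [:: 2; 4; 6] then
    \sum_(0 <= i < ((n - 1)./2).+1) 'C(n, n - i) * 'C(n - i, i.+1)
  else
    \sum_(0 <= i < ((n - 1)./2).+1) 'C(n, n - i) * 'C(n - i, i).

Definition attains (gT : finGroupType) (G : {group gT}) (n : nat) (p : 'I_n -> nat)
  (r : seq (nat * nat)) : Prop :=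
  [/\ rainbow n r, rsize n r = bound n,
      #|rainbow_arrows G p r| = rsize n r &
      minimal_genb G (rainbow_arrows G p r) (gen G (rainbow_arrows G p r))].

(* Main.v *)
Require Import Defs.
From mathcomp Require Import all_boot all_fingroup all_solvable.
From mathcomp Require Import zify.

(* Minimality.  In a cyclic group of squarefree order, distinct arrows of a
   rainbow are never comparable componentwise: the levels force them into the
   same arc, and then to be equal.  For an arrow [(A, B)] the arrows [(H, K)]
   such that [A <= H] and [B <= K] imply [B <= H] form a transfer system, which
   therefore contains all arrows of the rainbow but [(A, B)].

   Maximality.  An arc of length [b] has at most
   [max_arc n b = 'C(n, b) * 'C(n - b, (n - b)./2)] arrows, with equality only
   if its endpoints are as symmetric in [0..n] as possible.  The lengths of the
   arcs of a rainbow pairwise differ by at least 2, so they form an independent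
   set of the path [1 - 2 - ... - n].  By linear programming duality, weights
   [e i] on the edges [(i, i + 1)] such that [max_arc n b <= e (b - 1) + e b]
   bound the size of every rainbow by their sum.  For [n] odd or [n >= 8] there
   are such weights whose sum is the size of the complete rainbow: splitting
   [max_arc n b] between the edges at [b] for each length [b] of the parity of
   [n] dominates the other lengths by Pascal's rule.  Complementary slackness
   then yields uniqueness. *)

Set Implicit Arguments. Unset Strict Implicit. Unset Printing Implicit Defensive.

Lemma leqif_sum_seq (T : eqType) (r : seq T) (C : pred T) (F1 F2 : T -> nat) :
  {in r, forall x, F1 x <= F2 x ?= iff C x} ->
  \sum_(x <- r) F1 x <= \sum_(x <- r) F2 x ?= iff all C r.
Proof.
elim: r => [|x r IH] leF; first by rewrite !big_nil; apply/leqif_refl.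
rewrite !big_cons; apply: leqif_add; first by apply: leF; apply: mem_head.
by apply: IH => y yr; apply: leF; rewrite inE yr orbT.
Qed.

(** * Binomial coefficients *)

Lemma mul_bin_bin n h b : b <= h <= n ->
  'C(n, h) * 'C(h, b) = 'C(n, b) * 'C(n - b, h - b).
Proof.
case/andP=> bh hn; have bn := leq_trans bh hn.
have factors_gt0 : 0 < b`! * (h - b)`! * (n - h)`!.
  by rewrite !muln_gt0 !fact_gt0.
apply/eqP; rewrite -(eqn_pmul2r factors_gt0); apply/eqP; transitivity n`!.
  by rewrite -(bin_fact hn) -(bin_fact bh); lia.
rewrite -(bin_fact bn) -(bin_fact (leq_sub2r b hn)).
by rewrite (_ : n - b - (h - b) = n - h); lia.
Qed.

Lemma ltn_bin_succ n k : k.*2.+1 < n -> 'C(n, k) < 'C(n, k.+1).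
Proof.
move=> kn; have := mul_bin_left n k.
by have : 0 < 'C(n, k) by [rewrite bin_gt0; lia]; nia.
Qed.

Lemma ltn_bin_pred n k : n <= k.*2 -> k <= n -> 'C(n, k.+1) < 'C(n, k).
Proof.
move=> nk kn; have := mul_bin_left n k.
by have : 0 < 'C(n, k) by [rewrite bin_gt0]; nia.
Qed.

Lemma mul_bin_subS n k : k <= n ->
  k.+1 * ('C(n, k) - 'C(n, k.+1)) = (k.*2.+1 - n) * 'C(n, k).
Proof.
by move=> kn; rewrite mulnBr mul_bin_left -mulnBl; congr (_ * _); lia.
Qed.

Lemma ltn_bin_half n k l : k < l -> l <= n./2 -> 'C(n, k) < 'C(n, l).
Proof.
elim: l => // l IH; rewrite ltnS leq_eqVlt => /predU1P[-> | kl] ln.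
  by apply: ltn_bin_succ; lia.
by apply: ltn_trans (IH kl _) (ltn_bin_succ _); lia.
Qed.

Lemma bin_leqif_half n k :
  'C(n, k) <= 'C(n, n./2) ?= iff ((k == n./2) || (k == uphalf n)).
Proof.
have half_le : n./2 <= n by lia.
have below l : l <= n./2 -> 'C(n, l) <= 'C(n, n./2) ?= iff (l == n./2).
  rewrite leq_eqVlt => /predU1P[-> | l_lt].
    by rewrite eqxx; apply/leqif_refl.
  by apply/leqifP; rewrite ltn_eqF ?ltn_bin_half.
have [k_le | half_lt] := leqP k n./2.
  by rewrite (_ : _ || _ = (k == n./2)); [apply: below | lia].
have [kn | nk] := leqP k n; last first.
  by apply/leqifP; rewrite (bin_small nk) bin_gt0 half_le ifF //; lia.
rewrite -(bin_sub kn) (_ : _ || _ = (n - k == n./2)); last lia.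
by apply: below; lia.
Qed.

Lemma leqif_mul_bin_subS n i h : n + i = h.*2 -> i.+2 <= n ->
  'C(n, h.+1) * 'C(h, i.+1) <=
    ('C(n, h.+1) - 'C(n, h.+2)) * 'C(h.+1, i.+2) ?= iff (i.+2 == n).
Proof.
move=> ni i_n; set A := 'C(n, h.+1); set C := 'C(h.+1, i.+2).
have AC_gt0 : 0 < A * C by rewrite muln_gt0 !bin_gt0; lia.
have mul_sub : h.+2 * (A - 'C(n, h.+2)) = i.+3 * A.
  by rewrite mul_bin_subS; [congr (_ * _) | ]; lia.
have mul_diag : h.+1 * 'C(h, i.+1) = i.+2 * C := mul_bin_diag h.+1 i.+1.
rewrite -(mono_leqif (fun x y => @leq_pmul2l (h.+1 * h.+2) x y isT)).
have -> : h.+1 * h.+2 * (A * 'C(h, i.+1)) = i.+2 * h.+2 * (A * C).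
  transitivity (h.+2 * A * (h.+1 * 'C(h, i.+1))); first lia.
  by rewrite mul_diag; lia.
have -> : h.+1 * h.+2 * ((A - 'C(n, h.+2)) * C) = i.+3 * h.+1 * (A * C).
  transitivity (h.+1 * C * (h.+2 * (A - 'C(n, h.+2)))); first lia.
  by rewrite mul_sub; lia.
rewrite (mono_leqif (fun x y => @leq_pmul2r _ x y AC_gt0)).
by split; [nia | apply/eqP/eqP; nia].
Qed.

(** * Sizes of arcs *)

Definition arc_length (a : nat * nat) := a.2 - a.1.

Definition max_arc n b := 'C(n, b) * 'C(n - b, (n - b)./2).

Lemma multinomE n x y : x <= y <= n -> multinom n x y = 'C(n, y) * 'C(y, x).
Proof.
case/andP=> xy yn; rewrite /multinom -(bin_fact yn) -(bin_fact xy).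
set d := x`! * _ * _; set a := 'C(n, y); set b := 'C(y, x).
rewrite [X in X %/ _](_ : _ = a * b * d); last by rewrite /d; lia.
by rewrite mulnK // !muln_gt0 !fact_gt0.
Qed.

Lemma multinom_arc_length n x y : x <= y <= n ->
  multinom n x y = 'C(n, y - x) * 'C(n - (y - x), x).
Proof.
move=> xyn; have [xy yn] := andP xyn.
by rewrite multinomE // -(bin_sub xy) mul_bin_bin ?subKn ?leq_subr.
Qed.

Lemma multinom_leqif_max_arc n x y (b := y - x) : x <= y <= n ->
  multinom n x y <= max_arc n b ?=
    iff ((x == (n - b)./2) || (x == uphalf (n - b))).
Proof.
move=> xyn; rewrite multinom_arc_length //.
by apply/leqifP; have := bin_leqif_half (n - b) x => /leqifP;
  case: ifP => _; rewrite ?eqn_pmul2l ?ltn_pmul2l ?bin_gt0 //; lia.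
Qed.

Lemma max_arcE n b h : b <= n -> h \in [:: (n + b)./2; uphalf (n + b)] ->
  max_arc n b = 'C(n, h) * 'C(h, b).
Proof.
rewrite !inE => bn h_mid; rewrite mul_bin_bin; last by lia.
by congr (_ * _); apply/esym/eqP; rewrite (eq_leqif (bin_leqif_half _ _)); lia.
Qed.

(** * Rainbows *)

Definition nested (a b : nat * nat) := (a.1 < b.1) && (b.2 < a.2).

Lemma rainbow_pairwise_nested n r : rainbow n r -> pairwise nested r.
Proof.
case/and5P=> _ incr decr _ _.
rewrite -sorted_pairwise; last by move=> b a c; rewrite /nested; lia.
have := sorted_relI (relpre fst ltn) (relpre snd gtn) r.
by rewrite -!sorted_map incr decr.
Qed.

Lemma pairwise_total (T : eqType) (e : rel T) s : pairwise e s ->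
  {in s &, forall x y, [|| x == y, e x y | e y x]}.
Proof.
elim: s => // z s IH /= /andP[/allP z_s /IH s_total] x y; rewrite !inE.
case/predU1P=> [-> | xs] /predU1P[-> | ys].
- by rewrite eqxx.
- by rewrite z_s ?orbT.
- by rewrite z_s ?orbT.
- exact: s_total.
Qed.

Lemma rainbow_arc n r : rainbow n r -> {in r, forall a, a.1 < a.2 <= n}.
Proof.
move=> rb a ar; have /and5P[_ _ _ last_arc /allP/(_ a ar) ->] := rb.
rewrite andbT; case/lastP: r => // r l in rb ar last_arc *.
have := rainbow_pairwise_nested rb; rewrite last_rcons in last_arc.
rewrite pairwise_rcons => /andP[/allP r_l _]; move: ar.
by rewrite mem_rcons => /predU1P[-> // | /r_l]; rewrite /nested; lia.
Qed.

Lemma rainbow_total n r : rainbow n r ->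
  {in r &, forall a b, [|| a == b, nested a b | nested b a]}.
Proof. by move/rainbow_pairwise_nested/pairwise_total. Qed.

Lemma rainbow_arc_length_inj n r : rainbow n r ->
  {in r &, forall a b,
     arc_length a <= arc_length b <= (arc_length a).+1 -> a = b}.
Proof.
move=> rb a b ar br; have := rainbow_arc rb ar; have := rainbow_arc rb br.
case/or3P: (rainbow_total rb ar br) => [/eqP-> // | |].
all: rewrite /nested /arc_length; lia.
Qed.

Lemma rainbow_uniq n r : rainbow n r -> uniq r.
Proof.
case/and5P=> _ incr _ _ _; apply: (@map_uniq _ _ fst).
exact: sorted_uniq ltn_trans ltnn _ incr.
Qed.

Definition arc_lengths r := [seq arc_length a | a <- r].

Lemma rainbow_arc_lengths_uniq n r : rainbow n r -> uniq (arc_lengths r).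
Proof.
move=> rb; rewrite map_inj_in_uniq ?(rainbow_uniq rb) // => a b ar br eq_ab.
by apply: (rainbow_arc_length_inj rb); rewrite ?eq_ab ?leqnn ?leqnSn.
Qed.

Lemma rainbow_arc_lengths_range n r : rainbow n r ->
  {in arc_lengths r, forall b, 0 < b <= n}.
Proof.
by move=> rb _ /mapP[a /(rainbow_arc rb) arc_a ->]; rewrite /arc_length; lia.
Qed.

Lemma rainbow_arc_lengths_sparse n r : rainbow n r ->
  {in arc_lengths r, forall b, b.+1 \notin arc_lengths r}.
Proof.
move=> rb _ /mapP[a ar ->]; apply/mapP => -[b br len_b].
have := rainbow_arc_length_inj rb ar br.
by rewrite -len_b leqnSn leqnn => /(_ isT) ab; move: len_b; rewrite ab; lia.
Qed.

Lemma rainbow_eq_mem n r r' : rainbow n r -> rainbow n r' -> r =i r' -> r = r'.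
Proof.
move=> /rainbow_pairwise_nested rb /rainbow_pairwise_nested rb'.
apply: (@irr_sorted_eq _ nested); rewrite ?pairwise_sorted //.
- by move=> b a c; rewrite /nested; lia.
- by move=> a; rewrite /nested ltnn.
Qed.

Lemma mem_complete_rainbow n (a : nat * nat) : 0 < n ->
  (a \in complete_rainbow n) = (a.1 < a.2) && (a.1 + a.2 == n).
Proof.
move=> n0; apply/mapP/andP => [[i] | [lt_a /eqP sum_a]].
  by rewrite mem_iota => i_lt -> /=; lia.
exists a.1; first by rewrite mem_iota; lia.
by rewrite [LHS]surjective_pairing -sum_a addKn.
Qed.

Lemma rainbow_complete n : 0 < n -> rainbow n (complete_rainbow n).
Proof.
move=> n0; apply/and5P; split=> //.
- by rewrite -map_comp map_id_in ?iota_ltn_sorted.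
- rewrite -map_comp sorted_map; apply: (@sub_in_sorted _ (gtn n.+1) ltn).
  + by move=> i j; rewrite !inE /=; lia.
  + by apply/allP => i; rewrite mem_iota /=; lia.
  + exact: iota_ltn_sorted.
- have : last (0, 0) (complete_rainbow n) \in complete_rainbow n.
    by rewrite /complete_rainbow /= mem_last.
  by rewrite mem_complete_rainbow // => /andP[].
- by apply/allP => a; rewrite mem_complete_rainbow //=; lia.
Qed.

(** * Weak duality *)

Definition edges_covered n (e : nat -> nat) (s : seq nat) :=
  all (fun i => [|| e i == 0, i \in s | i.+1 \in s]) (index_iota 0 n.+1).

Section WeakDuality.
Variables (n : nat) (e : nat -> nat) (s : seq nat).
Hypotheses (s_uniq : uniq s) (s_range : {in s, forall b, 0 < b <= n}).

Lemma sum_incident_edges :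
  \sum_(b <- s) (e b.-1 + e b) =
    \sum_(0 <= i < n.+1) ((i \in s) + (i.+1 \in s)) * e i.
Proof.
have s0 : 0 \in s = false by apply/negbTE/negP => /s_range.
have sSn : n.+1 \in s = false by apply/negbTE/negP => /s_range; rewrite ltnn.
have perm_s : perm_eq s [seq b <- index_iota 0 n.+2 | b \in s].
  apply: uniq_perm => [//||b]; first by rewrite filter_uniq ?iota_uniq.
  rewrite mem_filter mem_index_iota; case sb: (b \in s) => //=.
  by have := s_range sb; lia.
rewrite (perm_big _ perm_s) big_filter big_split /= addnC.
under [RHS]eq_bigr do rewrite mulnDl.
rewrite [RHS]big_split /=; congr (_ + _).
  rewrite big_mkcond big_nat_recr //= sSn addn0.
  by apply: eq_bigr => i _; case: (i \in s); rewrite ?mul1n.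
rewrite big_mkcond big_nat_recl //= s0 add0n.
by apply: eq_bigr => i _; case: (i.+1 \in s); rewrite ?mul1n.
Qed.

Lemma leqif_sum_incident_edges : {in s, forall b, b.+1 \notin s} ->
  \sum_(b <- s) (e b.-1 + e b) <= \sum_(0 <= i < n.+1) e i ?=
    iff edges_covered n e s.
Proof.
move=> s_sparse; rewrite sum_incident_edges; apply: leqif_sum_seq => i _.
case s_i: (i \in s).
  by rewrite (negPf (s_sparse i s_i)) mul1n orbT; apply/leqif_refl.
case: (i.+1 \in s); first by rewrite mul1n !orbT; apply/leqif_refl.
by rewrite mul0n !orbF eq_sym; apply: leqif_eq.
Qed.

End WeakDuality.

Definition arcs_tight n (e : nat -> nat) (r : seq (nat * nat)) :=
  all (fun a => multinom n a.1 a.2 == e (arc_length a).-1 + e (arc_length a)) r.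

Lemma rsize_leqif_sum_edges n e r : rainbow n r ->
  (forall b, 0 < b <= n -> max_arc n b <= e b.-1 + e b) ->
  rsize n r <= \sum_(0 <= i < n.+1) e i ?=
    iff arcs_tight n e r && edges_covered n e (arc_lengths r).
Proof.
move=> rb e_dom.
have := leqif_sum_incident_edges e (rainbow_arc_lengths_uniq rb)
  (rainbow_arc_lengths_range rb) (rainbow_arc_lengths_sparse rb).
rewrite big_map; apply: leqif_trans; apply: leqif_sum_seq => a ar.
apply: leqif_eq.
have /andP[lt_a a_n] := rainbow_arc rb ar.
apply: leq_trans (e_dom _ _); last by rewrite /arc_length; lia.
by rewrite multinom_leqif_max_arc // ltnW.
Qed.

(** * The dual solution *)

(* The parts of [max_arc n k] given to the edges [(k, k + 1)] and [(k - 1, k)]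
   by a length [k] of the parity of [n].  With [h = (n + k) / 2], Pascal's rule
   writes [max_arc n k.+1] as the sum of ['C(n, h.+1) * 'C(h, k)], which is
   [up_share n k], and ['C(n, h.+1) * 'C(h, k.+1)], which is at most
   [down_share n k.+2]. *)
Definition up_share n k :=
  let h := (n + k)./2 in 'C(n, h.+1) * 'C(h, k).

Definition down_share n k :=
  let h := (n + k)./2 in ('C(n, h) - 'C(n, h.+1)) * 'C(h, k).

Lemma up_share_gt0 n k : k < n -> 0 < up_share n k.
Proof. by move=> kn; rewrite muln_gt0 !bin_gt0; lia. Qed.

Lemma down_share_gt0 n k : 0 < k <= n -> 0 < down_share n k.
Proof.
by move=> kn; rewrite muln_gt0 subn_gt0 bin_gt0 ltn_bin_pred; lia.
Qed.

Lemma down_shareD_up_share n k : k <= n -> ~~ odd (n + k) ->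
  down_share n k + up_share n k = max_arc n k.
Proof.
move=> kn nk; rewrite (max_arcE kn (mem_head _ _)) -mulnDl subnK //.
by rewrite ltnW // ltn_bin_pred; lia.
Qed.

Lemma max_arc_leqif_shares n i : ~~ odd (n + i) -> i.+2 <= n ->
  max_arc n i.+1 <= up_share n i + down_share n i.+2 ?= iff (i.+2 == n).
Proof.
move=> ni i_n; pose h := (n + i)./2.
have h_mid : h.+1 \in [:: (n + i.+1)./2; uphalf (n + i.+1)].
  by rewrite !inE; lia.
rewrite (max_arcE (ltnW i_n) h_mid) /up_share /down_share.
rewrite (_ : (n + i.+2)./2 = h.+1) -/h; last lia.
rewrite binS mulnDr addnC; apply: (leqif_add (C1 := true)).
  exact/leqif_refl.
by apply: leqif_mul_bin_subS; lia.
Qed.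

Lemma max_arc1_le_down_share2 n : ~~ odd n -> 8 <= n ->
  max_arc n 1 <= down_share n 2.
Proof.
move=> n_even n_ge8; pose h := (n + 2)./2.
have h_mid : h \in [:: (n + 1)./2; uphalf (n + 1)] by rewrite !inE; lia.
rewrite (max_arcE (ltnW (ltnW _)) h_mid) ?bin1 /down_share -/h; last lia.
have mul_sub : h.+1 * ('C(n, h) - 'C(n, h.+1)) = 3 * 'C(n, h).
  by rewrite mul_bin_subS; [congr (_ * _) | ]; lia.
have mul_diag := mul_bin_diag h 1; rewrite bin1 in mul_diag.
have h_ge5 : 5 <= h by lia.
move: 'C(n, h) 'C(h, 2) ('C(n, h) - 'C(n, h.+1)) mul_sub mul_diag => A C D.
by nia.
Qed.

(* No arc has length 0, so the edge [(0, 1)] gets no share from 0. *)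
Definition edge_weight n i :=
  if odd (n + i) then down_share n i.+1 else (0 < i) * up_share n i.

Lemma edge_weight_gt0 n i : i < n -> odd n || (0 < i) -> 0 < edge_weight n i.
Proof.
move=> i_n i_ok; rewrite /edge_weight; case: ifPn => ni.
  exact: down_share_gt0.
by rewrite muln_gt0 lt0b up_share_gt0 // andbT; lia.
Qed.

Lemma max_arc_eq_edge_weights n b : 0 < b <= n -> ~~ odd (n + b) ->
  max_arc n b = edge_weight n b.-1 + edge_weight n b.
Proof.
case: b => // b bn nb; rewrite /edge_weight (negPf nb) mul1n.
have -> : odd (n + b.+1.-1) by move: nb; rewrite addnS /= negbK.
by rewrite down_shareD_up_share.
Qed.

Lemma max_arc_leqif_edge_weights n b : 1 < b <= n -> odd (n + b) ->
  max_arc n b <= edge_weight n b.-1 + edge_weight n b ?= iff (b.+1 == n).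
Proof.
case: b => [|[|i]] // /andP[_ i_n] nb; rewrite /edge_weight nb /=.
have ni : ~~ odd (n + i.+1) by move: nb; rewrite addnS.
rewrite (negPf ni) mul1n; apply: max_arc_leqif_shares => //; move: nb; lia.
Qed.

Lemma max_arc_le_edge_weights n b : odd n || (8 <= n) -> 0 < b <= n ->
  max_arc n b <= edge_weight n b.-1 + edge_weight n b.
Proof.
move=> n_large bn; have [nb | nb] := boolP (odd (n + b)); last first.
  by rewrite max_arc_eq_edge_weights.
have [b1 | b_gt1] := leqP b 1; last first.
  by rewrite max_arc_leqif_edge_weights //; lia.
have n_even : ~~ odd n by move: nb; lia.
have -> : b = 1 by lia.
rewrite /edge_weight addn0 (negPf n_even) addn1 /= n_even.
by apply: max_arc1_le_down_share2; rewrite // (negPf n_even) in n_large.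
Qed.

Lemma mem_arc_lengths_complete n b : 0 < n ->
  (b \in arc_lengths (complete_rainbow n)) = (0 < b <= n) && ~~ odd (n + b).
Proof.
move=> n0; apply/mapP/idP => [[a] | b_ok].
  rewrite mem_complete_rainbow // /arc_length => /andP[lt_a /eqP sum_a] b_eq.
  by lia.
exists ((n - b)./2, (n + b)./2); last by rewrite /arc_length /=; lia.
by rewrite mem_complete_rainbow //=; lia.
Qed.

Lemma multinom_complete n (a : nat * nat) : 0 < n -> a \in complete_rainbow n ->
  multinom n a.1 a.2 = max_arc n (arc_length a).
Proof.
move=> n0; rewrite mem_complete_rainbow // => /andP[lt_a /eqP sum_a].
by apply/eqP; rewrite (eq_leqif (multinom_leqif_max_arc _)) /arc_length; lia.
Qed.

Lemma sum_edge_weight n : odd n || (8 <= n) ->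
  \sum_(0 <= i < n.+1) edge_weight n i = rsize n (complete_rainbow n).
Proof.
move=> n_large; have n0 : 0 < n by lia.
have dominates b := @max_arc_le_edge_weights n b n_large.
have leqif := rsize_leqif_sum_edges (rainbow_complete n0) dominates.
apply/esym/eqP; rewrite (eq_leqif leqif).
apply/andP; split; apply/allP.
  move=> a a_complete; have := map_f arc_length a_complete.
  rewrite mem_arc_lengths_complete // => /andP[len_range len_parity].
  by rewrite multinom_complete // max_arc_eq_edge_weights.
move=> i; rewrite mem_index_iota !mem_arc_lengths_complete // => i_n.
have [->|i0] := posnP i; last lia.
by rewrite /edge_weight; case: ifP; lia.
Qed.

Lemma boundE n : odd n || (8 <= n) -> bound n = rsize n (complete_rainbow n).
Proof.
move=> n_large; rewrite /bound ifN; last by rewrite !inE; lia.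
rewrite /rsize big_map /index_iota subn0; apply: eq_big_seq => i.
by rewrite mem_iota => i_lt; rewrite multinomE //=; lia.
Qed.

Lemma rsize_leqif_bound n r : odd n || (8 <= n) -> rainbow n r ->
  rsize n r <= bound n ?= iff
    arcs_tight n (edge_weight n) r &&
    edges_covered n (edge_weight n) (arc_lengths r).
Proof.
move=> n_large rb; rewrite boundE // -sum_edge_weight //.
by apply: rsize_leqif_sum_edges => // b; apply: max_arc_le_edge_weights.
Qed.

Lemma rsize_le_sumn n (e : seq nat) r : size e = n.+1 ->
  all (fun b => max_arc n b <= nth 0 e b.-1 + nth 0 e b) (iota 1 n) ->
  rainbow n r -> rsize n r <= sumn e.
Proof.
move=> size_e /allP e_dom rb; rewrite sumnE (big_nth 0) size_e.
by apply: rsize_leqif_sum_edges => // b bn; apply: e_dom; rewrite mem_iota; lia.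
Qed.

Lemma rsize_le_bound n r : 0 < n -> rainbow n r -> rsize n r <= bound n.
Proof.
move=> n0 rb; have [n_large | n_small] := boolP (odd n || (8 <= n)).
  by rewrite rsize_leqif_bound.
have : n \in [:: 2; 4; 6] by rewrite !inE; lia.
rewrite !inE => /or3P[] /eqP n_eq; rewrite n_eq in rb *.
(* Optimal edge weights for the three exceptional values of [n]. *)
- have := @rsize_le_sumn 2 [:: 0; 2; 0] r erefl isT rb.
  by rewrite /bound unlock.
- have := @rsize_le_sumn 4 [:: 0; 12; 0; 4; 0] r erefl isT rb.
  by rewrite /bound unlock.
- have := @rsize_le_sumn 6 [:: 0; 60; 30; 30; 0; 6; 0] r erefl isT rb.
  by rewrite /bound unlock.
Qed.

Lemma alternating_mem (s : seq nat) n :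
  (forall i, 0 < i < n -> (i.+1 \in s) = (i \notin s)) ->
  forall b, 0 < b <= n -> (b \in s) = (odd b == (1 \in s)).
Proof.
move=> alternating; elim=> // -[|b] IH bn; first by case: (1 \in s).
by rewrite alternating ?IH /=; try lia; case: (odd b) (1 \in s) => -[].
Qed.

Section Uniqueness.
Variables (n : nat) (r : seq (nat * nat)).
Hypotheses (n_large : odd n || (8 <= n)) (rb : rainbow n r).
Hypothesis r_max : rsize n r = bound n.

Lemma max_rainbow_covers i : i < n -> odd n || (0 < i) ->
  (i \in arc_lengths r) || (i.+1 \in arc_lengths r).
Proof.
have/eqP := r_max; rewrite (eq_leqif (rsize_leqif_bound n_large rb)).
move=> /andP[_ /allP covered] i_n i_ok; have := covered i.
by rewrite mem_index_iota gtn_eqF ?edge_weight_gt0 //; apply; lia.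
Qed.

Lemma max_rainbow_tight (a : nat * nat) (b := arc_length a) : a \in r ->
  multinom n a.1 a.2 = max_arc n b /\
  max_arc n b = edge_weight n b.-1 + edge_weight n b.
Proof.
move=> ar; have/eqP := r_max; rewrite (eq_leqif (rsize_leqif_bound n_large rb)).
move=> /andP[/allP/(_ a ar)/eqP tight _].
have /andP[/ltnW a_le a_n] := rainbow_arc rb ar.
have le_max : multinom n a.1 a.2 <= max_arc n b.
  by rewrite multinom_leqif_max_arc // a_le.
have : max_arc n b <= edge_weight n b.-1 + edge_weight n b.
  by apply: max_arc_le_edge_weights (rainbow_arc_lengths_range rb (map_f _ ar)).
by move: le_max; rewrite -/b in tight; rewrite tight; lia.
Qed.

(* The shortest length has the parity of [n]: for [n] odd, the edge [(0, 1)] can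
   only be covered by 1; for [n] even, 1 would entail 3, which is not tight. *)
Lemma max_rainbow_lengths b : 0 < b <= n ->
  (b \in arc_lengths r) = ~~ odd (n + b).
Proof.
have alternating i : 0 < i < n ->
    (i.+1 \in arc_lengths r) = (i \notin arc_lengths r).
  move=> /andP[i0 i_n]; have := max_rainbow_covers i_n; rewrite i0 orbT.
  move=> /(_ isT); case i_r: (i \in _) => //= _.
  exact/negbTE/(rainbow_arc_lengths_sparse rb).
move=> bn; rewrite (alternating_mem alternating) //.
suff -> : (1 \in arc_lengths r) = odd n by rewrite oddD negb_add eq_sym.
have [n_odd | n_even] := boolP (odd n).
  have := max_rainbow_covers (odd_gt0 n_odd); rewrite n_odd => /(_ isT).
  by case/orP=> // /(rainbow_arc_lengths_range rb).
apply/negbTE/negP => one_len; have : 3 \in arc_lengths r.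
  by rewrite (alternating_mem alternating) ?one_len //; lia.
move=> /mapP[a ar len3]; have [_ /eqP] := max_rainbow_tight ar; rewrite -len3.
by rewrite (eq_leqif (max_arc_leqif_edge_weights _ _)); lia.
Qed.

Lemma max_rainbow_complete : r = complete_rainbow n.
Proof.
have n0 : 0 < n by lia.
have sub_complete : {subset r <= complete_rainbow n}.
  move=> a ar; have arc_a := rainbow_arc rb ar.
  have len_range := rainbow_arc_lengths_range rb (map_f _ ar).
  have := max_rainbow_lengths len_range; rewrite map_f // => /esym.
  have [/eqP] := max_rainbow_tight ar; rewrite mem_complete_rainbow //.
  by rewrite (eq_leqif (multinom_leqif_max_arc _)) /arc_length; lia.
apply: (rainbow_eq_mem rb (rainbow_complete n0)) => a; apply/idP/idP.
  exact: sub_complete.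
move=> a_complete; have := map_f arc_length a_complete.
rewrite mem_arc_lengths_complete // => /andP[len_range len_parity].
move: (max_rainbow_lengths len_range); rewrite len_parity => /mapP[b br eq_len].
have b_complete := sub_complete b br.
rewrite (rainbow_arc_length_inj (rainbow_complete n0) a_complete b_complete) //.
by rewrite eq_len leqnn leqnSn.
Qed.

End Uniqueness.

Lemma Rx_half n : ~~ odd n -> 0 < n -> Rx n n./2 = complete_rainbow n.
Proof.
move=> n_even n0; rewrite /Rx /complete_rainbow.
have -> : ((n - 1)./2).+1 = n./2 by lia.
have -> : [seq k <- iota 0 n.+1 | k != n./2] = iota 0 n./2 ++ iota n./2.+1 n./2.
  have -> : n.+1 = n./2 + 1 + n./2 by lia.
  rewrite !iotaD !filter_cat /= add0n eqxx addn1 cats0.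
  by congr (_ ++ _); apply/all_filterP/allP => i; rewrite mem_iota; lia.
apply/eq_in_map => i; rewrite mem_iota /= add0n => i_lt.
rewrite !nth_cat size_iota i_lt ifN; last by lia.
by rewrite !nth_iota //; try lia; congr (_, _); lia.
Qed.

Lemma rainbow_Rx_small n x : n \in [:: 2; 4; 6] -> x \in [:: 0; n] ->
  rainbow n (Rx n x) /\ rsize n (Rx n x) = bound n.
Proof.
rewrite !inE => /or3P[] /eqP-> /orP[] /eqP->; split=> //.
all: by rewrite /rsize /bound unlock.
Qed.

(** * Transfer systems *)

Section TransferSystemTheory.
Variables (gT : finGroupType) (G : {group gT}).
Implicit Types (S T : {set arrow_type gT}) (A B H K L : {group gT}).

Lemma transferP T : reflect
  [/\ {in T, forall a, is_arrow G a},
      forall H, H \subset G -> (H, H) \in T,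
      forall H K L, (H, K) \in T -> (K, L) \in T -> (H, L) \in T,
      forall H K g, g \in G -> (H, K) \in T -> ((H :^ g)%G, (K :^ g)%G) \in T &
      forall H K L, (H, K) \in T -> L \subset K -> ((H :&: L)%G, L) \in T]
  (transferb G T).
Proof.
apply: (iffP and5P) => [] [arrT idT compT conjT resT]; split.
- exact/forall_inP.
- by move=> H; move/forallP/(_ H)/implyP: idT.
- move=> H K L HK KL; move/'forall_'forall_forallP/(_ H K L)/implyP: compT.
  by apply; rewrite HK.
- move=> H K g gG; move/'forall_forallP/(_ H K)/forall_inP/(_ g gG): conjT.
  exact/implyP.
- move=> H K L HK LK; move/'forall_'forall_forallP/(_ H K L)/implyP: resT.
  by apply; rewrite HK.
- exact/forall_inP.
- by apply/forallP => H; apply/implyP/idT.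
- apply/'forall_'forall_forallP => H K L; apply/implyP => /andP[].
  exact: compT.
- apply/'forall_forallP => H K; apply/forall_inP => g gG.
  exact/implyP/conjT.
- apply/'forall_'forall_forallP => H K L; apply/implyP => /andP[].
  exact: resT.
Qed.

Lemma sub_gen S : S \subset gen G S.
Proof. by apply/bigcapsP => T /andP[]. Qed.

Lemma gen_sub S T : transferb G T -> S \subset T -> gen G S \subset T.
Proof. by move=> tT ST; apply: bigcap_inf; rewrite tT. Qed.

Lemma genP S a : reflect
  (forall T, transferb G T -> S \subset T -> a \in T) (a \in gen G S).
Proof.
apply: (iffP bigcapP) => in_all T => [tT ST | /andP[]]; last exact: in_all.
by apply: in_all; rewrite tT.
Qed.

Lemma transfer_arrows : transferb G [set a | is_arrow G a].
Proof.
apply/transferP; split.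
- by move=> a; rewrite inE.
- by move=> H; rewrite inE /is_arrow /= subxx.
- move=> H K L; rewrite !inE /is_arrow /= => /andP[HK _] /andP[KL ->].
  by rewrite (subset_trans HK KL).
- move=> H K g gG; rewrite !inE /is_arrow /= conjSg => /andP[-> KG].
  by rewrite -(conjGid gG) conjSg.
- move=> H K L; rewrite !inE /is_arrow /= subsetIr => /andP[_ KG] LK.
  exact: subset_trans KG.
Qed.

Lemma transfer_gen S : {in S, forall a, is_arrow G a} -> transferb G (gen G S).
Proof.
move=> arrS; apply/transferP; split.
- have /subsetP gen_arrows : gen G S \subset [set a | is_arrow G a].
    by apply: gen_sub transfer_arrows _; apply/subsetP => a /arrS; rewrite inE.
  by move=> a /gen_arrows; rewrite inE.
- by move=> H HG; apply/genP => T /transferP[_ idT _ _ _] _; apply: idT.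
- move=> H K L /genP HK /genP KL; apply/genP => T tT ST.
  have /transferP[_ _ compT _ _] := tT.
  exact: compT (HK T tT ST) (KL T tT ST).
- move=> H K g gG /genP HK; apply/genP => T tT ST.
  by have /transferP[_ _ _ conjT _] := tT; apply: conjT gG (HK T tT ST).
- move=> H K L /genP HK LK; apply/genP => T tT ST.
  by have /transferP[_ _ _ _ resT] := tT; apply: resT (HK T tT ST) LK.
Qed.

Definition antichain S :=
  {in S &, forall a b : arrow_type gT,
     a.1 \subset b.1 -> a.2 \subset b.2 -> a = b}.

Definition avoiding A B : {set arrow_type gT} :=
  [set a | is_arrow G a &
     [&& A \subset a.1 & B \subset a.2] ==> (B \subset a.1)].

Lemma transfer_avoiding A B : abelian G -> transferb G (avoiding A B).
Proof.
move=> abG; have /transferP[_ idG compG conjG resG] := transfer_arrows.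
have arrowE a : (a \in [set b | is_arrow G b]) = is_arrow G a by rewrite inE.
have conj_id H g : g \in G -> H \subset G -> (H :^ g)%g = H.
  by move=> gG HG; apply: normsP (sub_abelian_norm abG HG) g gG.
apply/transferP; split.
- by move=> a; rewrite inE => /andP[].
- by move=> H HG; rewrite inE -arrowE idG //=; apply/implyP => /andP[].
- move=> H K L; rewrite !inE.
  move=> /andP[HK /implyP avoid_HK] /andP[KL /implyP avoid_KL].
  rewrite -arrowE (compG H K L) ?inE //=; apply/implyP => /andP[AH BL].
  apply: avoid_HK; rewrite AH avoid_KL // BL andbT.
  by case/andP: HK => HK _; apply: subset_trans HK.
- move=> H K g gG; rewrite !inE => /andP[HK avoid_HK].
  rewrite -arrowE conjG ?inE //=.
  by case/andP: HK => /= HK KG; rewrite !conj_id // (subset_trans HK).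
- move=> H K L; rewrite !inE => /andP[HK /implyP avoid_HK] LK.
  rewrite -arrowE (resG H K) ?inE //=; apply/implyP => /andP[].
  rewrite !subsetI => /andP[AH AL] BL; rewrite BL avoid_HK // AH.
  exact: subset_trans LK.
Qed.

Lemma minimal_gen_antichain S : abelian G -> {in S, forall a, is_arrow G a} ->
  {in S, forall a, a.1 != a.2} -> antichain S ->
  minimal_genb G S (gen G S).
Proof.
move=> abG arrS nontrivS antichainS; apply/and4P; split=> //.
- exact/forall_inP.
- exact: sub_gen.
apply/forall_inP => -[A B] AB_S; apply/eqP => gen_eq.
have others_avoid : S :\ (A, B) \subset avoiding A B.
  apply/subsetP => a; rewrite !inE => /andP[a_neq aS].
  rewrite arrS //=; apply/implyP => /andP[Aa Ba].
  by rewrite (antichainS (A, B) a) ?eqxx in a_neq.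
have : (A, B) \in avoiding A B.
  apply: subsetP (gen_sub (transfer_avoiding A B abG) others_avoid) _ _.
  by rewrite gen_eq (subsetP (sub_gen S)).
rewrite inE /= !subxx /= => /andP[_ BA].
have /andP[/= AB _] := arrS _ AB_S.
by case/eqP: (nontrivS _ AB_S); apply/val_inj/eqP; rewrite eqEsubset AB.
Qed.

Lemma leq_cfrak S : {in S, forall a, is_arrow G a} ->
  minimal_genb G S (gen G S) -> #|S| <= cfrak G.
Proof.
move=> arrS minS; apply: leq_trans (leq_bigmax_cond _ (transfer_gen arrS)).
exact: (@leq_bigmax_cond _ (fun S' => minimal_genb G S' (gen G S)) _ S).
Qed.

End TransferSystemTheory.

(** * Arcs and rainbows in squarefree cyclic groups *)

Lemma dvdn_prod_primes (T : finType) (p : T -> nat) (I J : {set T}) :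
  injective p -> (forall i, prime (p i)) ->
  (\prod_(i in I) p i %| \prod_(j in J) p j) = (I \subset J).
Proof.
move=> p_inj p_prime; apply/idP/idP => [I_dvd | IJ].
  apply/subsetP => i iI; have : p i %| \prod_(j in J) p j.
    by apply: dvdn_trans I_dvd; rewrite (bigD1 i) //= dvdn_mulr.
  rewrite Euclid_dvd_prod // big_has_cond => /hasP[j _ /andP[jJ]].
  by rewrite dvdn_prime2 // => /eqP/p_inj->.
by rewrite [X in _ %| X](big_setID I) /= (setIidPr IJ) dvdn_mulr.
Qed.

Definition flags (T : finType) x y : {set {set T} * {set T}} :=
  [set IJ : {set T} * {set T} |
     [&& IJ.1 \subset IJ.2, #|IJ.1| == x & #|IJ.2| == y]].

Lemma card_flags (T : finType) x y : #|flags T x y| = 'C(#|T|, y) * 'C(y, x).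
Proof.
rewrite -sum1_card (reindex_inj (can_inj (@swap_pairK _ _))) /=.
rewrite (eq_bigl (fun JI : {set T} * {set T} =>
   (#|JI.1| == y) && ((JI.2 \subset JI.1) && (#|JI.2| == x)))); last first.
  by case=> J I; rewrite inE /= [RHS]andbC andbA.
rewrite -(pair_big_dep (fun J : {set T} => #|J| == y)
  (fun J I : {set T} => (I \subset J) && (#|I| == x)) (fun _ _ => 1)) /=.
rewrite (eq_bigr (fun=> 'C(y, x))) => [|J /eqP cJ].
  rewrite sum_nat_const; congr (_ * _).
  by rewrite -card_draws; apply: eq_card => J; rewrite inE.
by rewrite sum1_card -[in RHS]cJ -cards_draws; apply: eq_card => I; rewrite inE.
Qed.

Section SquarefreeCyclic.
Variables (gT : finGroupType) (G : {group gT}) (n : nat) (p : 'I_n -> nat).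
Hypotheses (p_inj : injective p) (p_prime : forall i, prime (p i)).
Hypotheses (cycG : cyclic G) (oG : #|G| = \prod_(i < n) p i).
Implicit Types I J : {set 'I_n}.

Let prime_prod I := \prod_(i in I) p i.

Lemma exists_subgroup I :
  exists H : {group gT}, (H \subset G) && (#|H| == prime_prod I).
Proof.
have /cyclicP[g defG] := cycG.
have I_dvd : prime_prod I %| #[g]%g.
  rewrite orderE -defG oG (_ : \prod_(i < n) p i = prime_prod setT).
    by rewrite dvdn_prod_primes ?subsetT.
  by apply: eq_bigl => i; rewrite inE.
have := cycle_sub_group I_dvd; set H := <[_]>%G => /setP/(_ H).
by rewrite !inE eqxx -defG; exists H.
Qed.

Definition subgroup_of I : {group gT} := xchoose (exists_subgroup I).

Lemma subgroup_of_sub I : subgroup_of I \subset G.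
Proof. by case/andP: (xchooseP (exists_subgroup I)). Qed.

Lemma card_subgroup_of I : #|subgroup_of I| = prime_prod I.
Proof. by case/andP: (xchooseP (exists_subgroup I)) => _ /eqP. Qed.

Lemma subgroup_ofS I J : (subgroup_of I \subset subgroup_of J) = (I \subset J).
Proof.
by rewrite -(cardSg_cyclic cycG) ?subgroup_of_sub // !card_subgroup_of
  dvdn_prod_primes.
Qed.

Lemma subgroup_of_inj : injective subgroup_of.
Proof.
by move=> I J eqIJ; apply/eqP; rewrite eqEsubset -!subgroup_ofS eqIJ subxx.
Qed.

Lemma eq_subgroup_of (H : {group gT}) I : H \subset G -> #|H| = prime_prod I ->
  H = subgroup_of I.
Proof.
move=> HG oH; apply/val_inj/eqP.
by rewrite (eq_subG_cyclic cycG) ?subgroup_of_sub //= card_subgroup_of oH.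
Qed.

Lemma arc_arrowsE x y : arc_arrows G p x y =
  [set (subgroup_of IJ.1, subgroup_of IJ.2) | IJ in flags 'I_n x y].
Proof.
apply/setP => -[H K]; apply/idP/imsetP.
  rewrite inE => /and3P[/andP[/= HK KG]].
  case/existsP => I /andP[cI /eqP oH] /existsP[J /andP[cJ /eqP oK]].
  have HE := eq_subgroup_of (subset_trans HK KG) oH.
  have KE := eq_subgroup_of KG oK.
  exists (I, J); last by rewrite /= -HE -KE.
  by rewrite inE /= cI cJ -subgroup_ofS -HE -KE HK.
case=> -[I J]; rewrite inE /= => /and3P[IJ cI cJ] [-> ->].
rewrite inE /is_arrow /= subgroup_ofS IJ subgroup_of_sub /=; apply/andP; split.
  by apply/existsP; exists I; rewrite cI card_subgroup_of /=.
by apply/existsP; exists J; rewrite cJ card_subgroup_of /=.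
Qed.

Lemma card_arc_arrows x y : #|arc_arrows G p x y| = 'C(n, y) * 'C(y, x).
Proof.
rewrite arc_arrowsE card_imset ?card_flags ?card_ord //.
by move=> [I J] [I' J'] [/subgroup_of_inj-> /subgroup_of_inj->].
Qed.

Lemma arc_arrows_le x y x' y' a b :
  a \in arc_arrows G p x y -> b \in arc_arrows G p x' y' ->
  a.1 \subset b.1 -> a.2 \subset b.2 -> x <= x' /\ y <= y'.
Proof.
rewrite !arc_arrowsE.
move=> /imsetP[[I J]]; rewrite inE => /and3P[_ /eqP<- /eqP<-] ->.
move=> /imsetP[[I' J']]; rewrite inE => /and3P[_ /eqP<- /eqP<-] -> /=.
by rewrite !subgroup_ofS => /subset_leq_card-> /subset_leq_card->.
Qed.

Lemma arc_arrows_antichain x y : antichain (arc_arrows G p x y).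
Proof.
rewrite arc_arrowsE => a b.
move=> /imsetP[[I J]]; rewrite inE => /and3P[_ /eqP cI /eqP cJ] ->.
move=> /imsetP[[I' J']]; rewrite inE => /and3P[_ /eqP cI' /eqP cJ'] -> /=.
rewrite !subgroup_ofS => II' JJ'.
have /eqP-> : I == I' by rewrite eqEcard II' cI -cI' /=.
by have /eqP-> : J == J' by rewrite eqEcard JJ' cJ -cJ' /=.
Qed.

Lemma rainbow_arrowsP r a : reflect
  (exists2 c, c \in r & a \in arc_arrows G p c.1 c.2)
  (a \in rainbow_arrows G p r).
Proof.
rewrite /rainbow_arrows; elim: r => [|c r IH].
  by rewrite big_nil inE; constructor=> -[].
rewrite big_cons inE; apply: (iffP orP) => [[ac | /IH[c' c'r ac']] | [c']].
- by exists c; rewrite ?mem_head.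
- by exists c'; rewrite // inE c'r orbT.
- by rewrite inE => /predU1P[-> | c'r] ac; [left | right; apply/IH; exists c'].
Qed.

Lemma rainbow_arrows_arrow r :
  {in rainbow_arrows G p r, forall a, is_arrow G a}.
Proof. by move=> a /rainbow_arrowsP[c _]; rewrite inE => /andP[]. Qed.

Lemma arc_arrows_inj x y x' y' a : a \in arc_arrows G p x y ->
  a \in arc_arrows G p x' y' -> (x, y) = (x', y').
Proof.
move=> a_xy a_xy'.
have [le_x le_y] := arc_arrows_le a_xy a_xy' (subxx _) (subxx _).
have [ge_x ge_y] := arc_arrows_le a_xy' a_xy (subxx _) (subxx _).
by congr (_, _); apply/eqP; rewrite eqn_leq ?le_x ?le_y.
Qed.

Lemma card_rainbow_arrows r : rainbow n r ->
  #|rainbow_arrows G p r| = rsize n r.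
Proof.
move=> rb; have := rainbow_arc rb; have := rainbow_uniq rb.
rewrite /rsize {rb}; elim: r => [|c r IH].
  by rewrite /rainbow_arrows !big_nil cards0.
move=> /= /andP[c_notin r_uniq] arcs.
rewrite /rainbow_arrows !big_cons -/(rainbow_arrows G p r) cardsU.
have -> : arc_arrows G p c.1 c.2 :&: rainbow_arrows G p r = set0.
  apply/setP => a; rewrite in_set0 in_setI; apply/negP => /andP[ac].
  case/rainbow_arrowsP => c' c'r /(arc_arrows_inj ac).
  by rewrite -!surjective_pairing => cc'; rewrite cc' c'r in c_notin.
rewrite cards0 subn0 IH // => [|c' c'r]; last by rewrite arcs // inE c'r orbT.
have /andP[/ltnW c_le c_n] := arcs c (mem_head c r).
by rewrite card_arc_arrows multinomE // c_le.
Qed.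

Lemma rainbow_minimal_gen r : rainbow n r ->
  minimal_genb G (rainbow_arrows G p r) (gen G (rainbow_arrows G p r)).
Proof.
move=> rb; apply: minimal_gen_antichain; first exact: cyclic_abelian.
- exact: rainbow_arrows_arrow.
- move=> a /rainbow_arrowsP[c /(rainbow_arc rb)]; rewrite arc_arrowsE => arc_c.
  case/imsetP=> -[I J]; rewrite inE => /and3P[_ /eqP /= cI /eqP cJ] ->.
  by apply: contraTneq arc_c => /= /subgroup_of_inj IJ; rewrite -cI -cJ IJ ltnn.
move=> a b /rainbow_arrowsP[c cr ac] /rainbow_arrowsP[c' c'r bc'].
move=> sub_fst sub_snd.
have [le_fst le_snd] := arc_arrows_le ac bc' sub_fst sub_snd.
suff cc' : c = c'.
  by rewrite -cc' in bc'; apply: arc_arrows_antichain ac bc' sub_fst sub_snd.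
case/or3P: (rainbow_total rb cr c'r) => [/eqP // | |].
all: by rewrite /nested; lia.
Qed.

Lemma rainbow_attains r : rainbow n r -> rsize n r = bound n -> attains G p r.
Proof.
move=> rb r_max; split=> //; first exact: card_rainbow_arrows.
exact: rainbow_minimal_gen.
Qed.

Lemma attains_cfrak r : attains G p r -> bound n <= cfrak G.
Proof.
case=> _ <- <- minimal; apply: leq_cfrak minimal.
exact: rainbow_arrows_arrow.
Qed.

End SquarefreeCyclic.

Theorem theorem5p14 (gT : finGroupType) (G : {group gT}) (n : nat) (p : 'I_n -> nat) :
  0 < n -> injective p -> (forall i, prime (p i)) ->
  cyclic G -> #|G| = (\prod_(i < n) p i)%N ->
  [/\ bound n <= cfrak G,
      (forall r, rainbow n r -> rsize n r <= bound n),
      (odd n -> attains G p (complete_rainbow n)),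
      (~~ odd n -> 8 <= n ->
         attains G p (Rx n n./2) /\
         (forall r, rainbow n r -> rsize n r = bound n -> r = Rx n n./2)) &
      (n \in [:: 2; 4; 6] -> attains G p (Rx n 0) /\ attains G p (Rx n n))].
Proof.
move=> n0 p_inj p_prime cycG oG.
have attains_complete : odd n || (8 <= n) -> attains G p (complete_rainbow n).
  move=> n_large; apply: rainbow_attains => //; first exact: rainbow_complete.
  by rewrite boundE.
have attains_small x : n \in [:: 2; 4; 6] -> x \in [:: 0; n] ->
    attains G p (Rx n x).
  by move=> n_small /(rainbow_Rx_small n_small)[]; apply: rainbow_attains.
split.
- have [n_large | n_small] := boolP (odd n || (8 <= n)).
    exact: attains_cfrak (attains_complete n_large).
  have {}n_small : n \in [:: 2; 4; 6] by rewrite !inE; lia.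
  exact: attains_cfrak (attains_small 0 n_small (mem_head _ _)).
- by move=> r; apply: rsize_le_bound.
- by move=> n_odd; apply: attains_complete; rewrite n_odd.
- move=> n_even n_ge8; have n_large : odd n || (8 <= n) by rewrite n_ge8 orbT.
  rewrite Rx_half //; split; first exact: attains_complete.
  by move=> r; apply: max_rainbow_complete.
- move=> n_small; split; apply: (attains_small _ n_small).
    exact: mem_head.
  by rewrite !inE eqxx orbT.
Qed.
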